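(* Let $a,b$ be integers with $1\le a<b$. Then the set of L\'evy constants $\mathcal L([0;u_1,u_2,\ldots])$, where $u_1u_2\ldots$ ranges over all mechanical words over $\{a,b\}$ with intercept $0$ (i.e. $u=\mathbf s_{\theta,0}$ or $u=\mathbf s'_{\theta,0}$ for some $\theta\in[0,1]$), is equal to the interval $[\mathcal L([0;\overline{a}]),\ \mathcal L([0;\overline{b}])]$.
   Context: Let $a,b$ be distinct positive integers. For $\theta\in[0,1]$ and $0\le\rho<1$ define, for $n\ge1$, $s_n=a$ if $\lfloor n\theta+\rho\rfloor-\lfloor (n-1)\theta+\rho\rfloor=0$ and $s_n=b$ if this difference is $1$; and $s'_n=a$ if $\lceil n\theta+\rho\rceil-\lceil (n-1)\theta+\rho\rceil=0$ and $s'_n=b$ if it equals $1$. The infinite words $\mathbf s_{\theta,\rho}=(s_n)_{n\ge1}$ and $\mathbf s'_{\theta,\rho}=(s'_n)_{n\ge1}$ are the mechanical words of slope $\theta$ and intercept $\rho$. For an irrational real $\alpha=[a_0;a_1,\ldots]$, $Q_n(\alpha)$ is the denominator of $[a_0;a_1,\ldots,a_n]$, and $\alpha$ has a L\'evy constant $\mathcal L(\alpha)=\lim_{n\to\infty}\frac1n\log Q_n(\alpha)$ if this limit exists and is finite. $[0;\overline{a}]$ denotes the number $[0;a,a,a,\ldots]$. *)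

(* Defs.v *)
From HB Require Import structures.
From mathcomp Require Import all_boot all_order all_algebra.
From mathcomp Require Import all_classical all_reals all_analysis.

Set Implicit Arguments.
Unset Strict Implicit.
Unset Printing Implicit Defensive.

Import Order.TTheory GRing.Theory Num.Theory.
Import numFieldNormedType.Exports.

Local Open Scope classical_set_scope.
Local Open Scope ring_scope.

(* An infinite word u_1 u_2 ... is a function on nat whose value at 0 is never
   used by the definitions below. *)

(* For 0 <= theta <= 1 the two differences are always 0 or 1, so that the
   "else" branch is the case where the difference is 1. *)
Definition mech_floor (R : realType) (a b : nat) (theta rho : R) (n : nat)
    : nat :=
  if Num.floor (n%:R * theta + rho) - Num.floor ((n%:R - 1) * theta + rho) == 0
  then a else b.

Definition mech_ceil (R : realType) (a b : nat) (theta rho : R) (n : nat)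
    : nat :=
  if Num.ceil (n%:R * theta + rho) - Num.ceil ((n%:R - 1) * theta + rho) == 0
  then a else b.

Definition mechanical0 (R : realType) (a b : nat) : set (nat -> nat) :=
  [set u | exists2 theta : R, 0 <= theta <= 1 &
             u = mech_floor a b theta 0 \/ u = mech_ceil a b theta 0].

(* [x; s_0, s_1, ...], finite *)
Fixpoint cf_fin (x : int) (s : seq int) : rat :=
  if s is y :: s' then x%:Q + (cf_fin y s')^-1 else x%:Q.

(* [c_0; c_1, ..., c_n] *)
Definition cf_conv (c : nat -> int) (n : nat) : rat :=
  cf_fin (c 0%N) [seq c i | i <- iota 1 n].

(* [0; u_1, u_2, ...] *)
Definition cf_val (R : realType) (u : nat -> nat) : R :=
  limn (fun n : nat =>
    ratr (cf_conv (fun k => if k is 0%N then 0 else (u k)%:Z) n) : R).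

Fixpoint complete_quotient (R : realType) (alpha : R) (n : nat) : R :=
  if n is m.+1 then
    (complete_quotient alpha m - (Num.floor (complete_quotient alpha m))%:~R)^-1
  else alpha.

Definition partial_quotient (R : realType) (alpha : R) (n : nat) : int :=
  Num.floor (complete_quotient alpha n).

(* denq is the positive denominator in lowest terms. *)
Definition cf_denom (R : realType) (alpha : R) (n : nat) : int :=
  denq (cf_conv (partial_quotient alpha) n).

Definition levy_seq (R : realType) (alpha : R) (n : nat) : R :=
  n%:R^-1 * ln ((cf_denom alpha n)%:~R).

Definition has_levy_constant (R : realType) (alpha : R) : Prop :=
  irrational alpha /\ cvgn (levy_seq alpha).

(* Only meaningful under has_levy_constant. *)
Definition levy_constant (R : realType) (alpha : R) : R :=
  limn (levy_seq alpha).

(* Main.v *)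
Require Import Defs.
From HB Require Import structures.
From mathcomp Require Import all_boot all_order all_algebra.
From mathcomp Require Import all_classical all_reals all_analysis.
From mathcomp Require Import zify ring lra.

Import Order.TTheory GRing.Theory Num.Theory.
Import numFieldNormedType.Exports.

Local Open Scope classical_set_scope.
Local Open Scope ring_scope.

(* Write K(w) for the continuant of a word w, so that Q_n = K(u_1 ... u_n).
   Then K(v) K(w) <= K(v w) <= 2 K(v) K(w), and changing one letter of w changes
   K(w) by a factor at most b.  Given k, Dirichlet provides a reduced p / q with
   q <= k and |q theta - p| < 1 / k; let l be the largest multiple of q below
   k, so l > k / 2.  Since floor(n theta + rho) = floor((n p + c_n) / q) with
   c_n = floor(q rho + n (q theta - p)), and since c_n takes at most two
   consecutive values on a window of length l, switching at most once, each
   factor of length l of the word of slope theta is, up to two letters, the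
   juxtaposition of two pieces of the periodic word of slope p / q.  Its
   continuant therefore agrees with that of a power of the period up to a factor
   depending only on b.  Cutting the word into blocks of length l, the
   averages (1 / n) log Q_n are eventually within O(1 / k) of a quantity that
   depends only on p, q and l, uniformly for slopes near theta.  Hence the limit
   exists and is continuous in theta, and the intermediate value theorem
   concludes, the bounds being monotonicity of K. *)

(** * Continuants of factors of a word *)

Section Continuants.
Local Open Scope nat_scope.
Implicit Types (u v : nat -> nat) (i j m n : nat).

(* The continuant of u_(i+1), ..., u_(i+n). *)
Fixpoint continuant u i n : nat :=
  if n is n1.+1 then
    u i.+1 * continuant u i.+1 n1
    + (if n1 is n2.+1 then continuant u i.+2 n2 else 0)
  else 1.

Lemma continuantSS u i n :
  continuant u i n.+2 = u i.+1 * continuant u i.+1 n.+1 + continuant u i.+2 n.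
Proof. by []. Qed.

Lemma continuant1 u i : continuant u i 1 = u i.+1.
Proof. by rewrite /= muln1 addn0. Qed.

Lemma nat_ind2 (P : nat -> Prop) :
  P 0 -> P 1 -> (forall n, P n -> P n.+1 -> P n.+2) -> forall n, P n.
Proof.
move=> P0 P1 PS n; suff: P n /\ P n.+1 by case.
by elim: n => [|n [IH1 IH2]]; split => //; apply: PS.
Qed.

Lemma eq_continuant u v i j n :
  (forall k, k < n -> u (i + k).+1 = v (j + k).+1) ->
  continuant u i n = continuant v j n.
Proof.
elim/nat_ind2: n i j => [//|i j H|n IH1 IH2 i j H].
  by rewrite !continuant1; have := H 0 isT; rewrite !addn0.
rewrite !continuantSS; have := H 0 isT; rewrite !addn0 => ->.
rewrite (IH2 i.+1 j.+1) ?(IH1 i.+2 j.+2) // => k kn.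
  by have := H k.+2; rewrite !addnS !addSn; apply; lia.
by have := H k.+1; rewrite !addnS !addSn; apply; lia.
Qed.

Lemma continuant_gt0 u i n : (forall k, 0 < u k) -> 0 < continuant u i n.
Proof.
move=> u0; elim: n i => [//|n IH] i /=.
by rewrite addn_gt0 muln_gt0 u0 IH.
Qed.

Lemma continuant_behead_le u i n : (forall k, 0 < u k) ->
  continuant u i.+1 n <= continuant u i n.+1.
Proof. by move=> u0 /=; rewrite -[leqLHS]addn0 leq_add // leq_pmull. Qed.

Lemma continuant_cat_ge u i m n : (forall k, 0 < u k) ->
  continuant u i m * continuant u (i + m) n <= continuant u i (m + n).
Proof.
move=> u0; elim/nat_ind2: m i => [i|i|m IH1 IH2 i].
- by rewrite mul1n add0n addn0.
- by rewrite continuant1 add1n addn1 /= leq_addr.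
- rewrite continuantSS !addSn continuantSS mulnDl -mulnA.
  have := IH1 i.+2; have := IH2 i.+1; rewrite !addSn !addnS => h2 h1.
  by rewrite leq_add // leq_mul.
Qed.

(** In the classical identity K(v w) = K(v) K(w) + K(v') K(w'), with v' lacking the last letter of v
    and w' the first of w, the second product is at most the first. The induction proves the
    inequality directly. *)
Lemma continuant_cat_le u i m n : (forall k, 0 < u k) ->
  continuant u i (m + n) <= 2 * (continuant u i m * continuant u (i + m) n).
Proof.
move=> u0; elim/nat_ind2: m i => [i|i|m IH1 IH2 i].
- by rewrite mul1n add0n addn0 leq_pmull.
- rewrite continuant1 add1n addn1 mul2n -addnn.
  case: n => [|n]; first by rewrite continuant1 muln1; lia.
  rewrite continuantSS leq_add2l.
  by rewrite (leq_trans (continuant_behead_le _ _ _ u0)) // leq_pmull.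
- rewrite continuantSS !addSn continuantSS mulnDl mulnDr.
  have := IH1 i.+2; have := IH2 i.+1; rewrite !addSn !addnS => h2 h1.
  by rewrite leq_add // -mulnA mulnCA leq_mul.
Qed.

(** A continuant is a sum of monomials in which each letter occurs at most once. Weights [r k >= 1]
    also cover the monomials that omit the letter [k]. *)
Lemma continuant_scale_le u v i j n (r : nat -> nat) :
  (forall k, 0 < r k) ->
  (forall k, k < n -> u (i + k).+1 <= r k * v (j + k).+1) ->
  continuant u i n <= (\prod_(0 <= k < n) r k) * continuant v j n.
Proof.
elim/nat_ind2: n i j r => [i j r r0 H|i j r r0 H|n IH1 IH2 i j r r0 H].
- by rewrite big_nil.
- by rewrite !continuant1 big_nat1; have := H 0 isT; rewrite !addn0.
have h0 := H 0 isT; rewrite !addn0 in h0.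
have h1 : continuant u i.+1 n.+1 <=
    (\prod_(0 <= k < n.+1) r k.+1) * continuant v j.+1 n.+1.
  by apply: IH2 => // k kn; have := H k.+1 kn; rewrite !addnS.
have h2 : continuant u i.+2 n <=
    (\prod_(0 <= k < n) r k.+2) * continuant v j.+2 n.
  by apply: IH1 => // k kn; have := H k.+2 kn; rewrite !addnS.
rewrite !continuantSS big_nat_recl // mulnDr leq_add //.
  by rewrite mulnACA leq_mul.
rewrite (leq_trans h2) // leq_mul // big_nat_recl //.
by rewrite mulnA leq_pmull // muln_gt0 !r0.
Qed.

Lemma continuant_mono u v i j n :
  (forall k, k < n -> u (i + k).+1 <= v (j + k).+1) ->
  continuant u i n <= continuant v j n.
Proof.
move=> H; have := @continuant_scale_le u v i j n (fun=> 1).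
rewrite big1 // mul1n; apply => // k kn; rewrite mul1n; exact: H.
Qed.

Lemma continuant_le_exp u b i n : (forall k, u k <= b) ->
  continuant u i n <= b.+1 ^ n.
Proof.
move=> ub; elim/nat_ind2: n i => [//|i|n IH1 IH2 i].
  by rewrite continuant1 expn1 leqW.
rewrite continuantSS 2!expnS mulSn addnC leq_add // ?leq_mul -?expnS //.
by rewrite (leq_trans (IH1 _)) // expnS leq_pmull.
Qed.

End Continuants.

(** Estimates stay multiplicative and in [nat], so that constants multiply under transitivity and
    products. Logarithms enter only with [ln_within]. *)
Definition within (C m n : nat) : Prop := (m <= C * n)%N /\ (n <= C * m)%N.

Lemma within_sym C m n : within C m n -> within C n m.
Proof. by case. Qed.

Lemma within_trans C D l m n : within C l m -> within D m n -> within (C * D) l n.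
Proof. by case=> ? ? [? ?]; split; nia. Qed.

Lemma within_mul C D k l m n :
  within C k l -> within D m n -> within (C * D) (k * m) (l * n).
Proof. by case=> ? ? [? ?]; split; rewrite mulnACA leq_mul. Qed.

Lemma within_refl m : within 1 m m.
Proof. by split; rewrite mul1n. Qed.

Lemma within_cat u i m n : (forall k, 0 < u k)%N ->
  within 2 (continuant u i (m + n)) (continuant u i m * continuant u (i + m) n).
Proof.
move=> u0; split; first exact: continuant_cat_le.
by rewrite (leq_trans (continuant_cat_ge _ _ _ _ u0)) // leq_pmull.
Qed.

(** * Words coded by integer sequences, and periodic words of rational slope *)

Definition step_word (a b : nat) (x : nat -> int) (n : nat) : nat :=
  if x n == x n.-1 then a else b.

(* floor((n p + c) / q); the step word of this sequence is the periodic
   mechanical word of slope p / q and intercept c / q. *)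
Definition phase (p : int) (q : nat) (c : int) (n : nat) : int :=
  ((n%:Z * p + c) %/ q%:Z)%Z.

Section StepWords.
Variables (a b : nat).
Hypotheses (ha : (0 < a)%N) (hab : (a < b)%N).
Implicit Types (x y : nat -> int) (i j m n : nat).

Local Notation W := (step_word a b).
Local Notation K x i n := (continuant (step_word a b x) i n).

Lemma step_word_gt0 x k : (0 < W x k)%N.
Proof. by rewrite /step_word; case: ifP => _ //; lia. Qed.

Lemma step_word_le x k : (W x k <= b)%N.
Proof. by rewrite /step_word; case: ifP => _ //; lia. Qed.

(** Only the increments of the coding sequence matter. Translations of words and of intercepts are
    all handled through this. *)
Lemma continuant_step_shift x y (z : int) i j n :
  (forall k, (k <= n)%N -> x (i + k)%N = y (j + k)%N + z) ->
  K x i n = K y j n.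
Proof.
move=> H; apply: eq_continuant => k kn; rewrite /step_word /= -!addnS.
by rewrite !H ?(ltnW kn) // (inj_eq (addIr z)).
Qed.

Lemma prod_indicator_le (c k0 n : nat) : (0 < c)%N ->
  (\prod_(0 <= k < n) (if k == k0 then c else 1) <= c)%N.
Proof.
move=> c0; rewrite -big_mkcond /= (big_nat1_eq _ (fun=> c)).
by case: ifP.
Qed.

(** One value of the coding sequence enters two letters, the one that ends at it and the one that
    starts from it, and each costs a factor at most b. If [k0 = 0], the truncated predecessor only
    enlarges the bound. *)
Lemma continuant_step_except x y i j n k0 :
  (forall k, (k <= n)%N -> k <> k0 -> x (i + k)%N = y (j + k)%N) ->
  (K x i n <= b ^ 2 * K y j n)%N.
Proof.
move=> H; have b0 : (0 < b)%N by lia.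
pose r k := ((if k == k0 then b else 1) * (if k == k0.-1 then b else 1))%N.
apply: (@leq_trans ((\prod_(0 <= k < n) r k) * K y j n)%N).
  apply: continuant_scale_le => [k|k kn]; rewrite /r.
    by do 2!case: ifP => _; nia.
  have := step_word_le x (i + k).+1; have := step_word_gt0 y (j + k).+1.
  case: eqP => e1; first by case: eqP => _; nia.
  case: eqP => e2; first by nia.
  move=> _ _; rewrite !mul1n /step_word /= -!addnS !H ?(ltnW kn) //; lia.
rewrite leq_mul2r; apply/orP; right.
by rewrite big_split /= expnS expn1 leq_mul // prod_indicator_le.
Qed.

Lemma within_step_except x y i j n k0 :
  (forall k, (k <= n)%N -> k <> k0 -> x (i + k)%N = y (j + k)%N) ->
  within (b ^ 2) (K x i n) (K y j n).
Proof.
move=> H; split; apply: continuant_step_except => k kn /(H k kn) -> //.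
Qed.

Variables (p : int) (q : nat).
Hypotheses (q0 : (0 < q)%N) (cpq : coprimez p q%:Z).
Implicit Types c : int.

Lemma phase_shift c (z : int) j n :
  phase p q (j%:Z * p + z * q%:Z + c) n = phase p q c (n + j) + z.
Proof.
rewrite /phase [RHS]addrC -divzMDl; last by lia.
by congr (_ %/ _)%Z; rewrite PoszD; ring.
Qed.

Lemma phase_period c m n : phase p q c (m * q + n) = phase p q c n + m%:Z * p.
Proof.
rewrite /phase [RHS]addrC -divzMDl; last by lia.
by congr (_ %/ _)%Z; rewrite PoszD PoszM; ring.
Qed.

(** Bezout: if s p + t q = 1, take j = c s modulo q. With [phase_shift], every intercept then yields
    a rotation of the same periodic word. *)
Lemma phase_rotation c :
  exists2 j, (j < q)%N & exists z : int, c = j%:Z * p + z * q%:Z.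
Proof.
have /coprimezP[[s t] /= st] := cpq.
have h0 : 0 <= ((c * s) %% q%:Z)%Z by rewrite modz_ge0 //; lia.
have h1 : ((c * s) %% q%:Z)%Z < q%:Z by rewrite ltz_pmod.
exists `|((c * s) %% q%:Z)%Z|%N; first by lia.
exists (c * t + ((c * s) %/ q%:Z)%Z * p).
rewrite gez0_abs // -[LHS]mulr1 -st.
rewrite mulrDr !mulrA {1}(divz_eq (c * s) q%:Z); ring.
Qed.

Lemma continuant_phase_period c m i n :
  K (phase p q c) (m * q + i) n = K (phase p q c) i n.
Proof.
apply: (continuant_step_shift _ _ (m%:Z * p)) => k kn.
by rewrite -addnA phase_period.
Qed.

(** Over whole periods the two words are v w and w v, by rotation. Both continuants lie between K(v)
    K(w) and twice that, hence the factor 2. *)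
Lemma within_phase c m :
  within 2 (K (phase p q c) 0 (m * q)) (K (phase p q 0) 0 (m * q)).
Proof.
case: m => [|m]; first by split.
have [j jq [z cE]] := phase_rotation c.
set N := (m.+1 * q)%N.
have jN : (j <= N)%N by rewrite /N mulSn; lia.
have -> : K (phase p q c) 0 N = K (phase p q 0) j N.
  apply: (continuant_step_shift _ _ z) => k _.
  by rewrite cE -[_ + z * _]addr0 phase_shift add0n addnC.
have u0 := step_word_gt0 (phase p q 0).
have per : K (phase p q 0) N j = K (phase p q 0) 0 j.
  by rewrite -[N]addn0 continuant_phase_period.
have := continuant_cat_ge _ 0 j (N - j) u0.
have := continuant_cat_le _ 0 j (N - j) u0.
have := continuant_cat_ge _ j (N - j) j u0.
have := continuant_cat_le _ j (N - j) j u0.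
rewrite !add0n subnK // subnKC // per.
by split; lia.
Qed.

Lemma phase_succ c n : ~ (q%:Z %| n%:Z * p + c + 1)%Z ->
  phase p q (c + 1) n = phase p q c n.
Proof.
rewrite /phase addrA; set z := _ + c => h.
have := divz_eq z q%:Z; have := divz_eq (z + 1) q%:Z.
have : 0 <= (z %% q%:Z)%Z < q%:Z by rewrite modz_ge0 ?ltz_pmod //; lia.
have : 0 <= ((z + 1) %% q%:Z)%Z < q%:Z by rewrite modz_ge0 ?ltz_pmod //; lia.
have : ((z + 1) %% q%:Z)%Z <> 0 by move/dvdz_mod0P.
set r := (z %% q%:Z)%Z; set r' := ((z + 1) %% q%:Z)%Z.
set s := (z %/ q%:Z)%Z; set s' := ((z + 1) %/ q%:Z)%Z.
move=> h1 h2 h3 h4 h5.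
(* Since r' is nonzero, the right-hand side lies strictly between -q and q, which forces s' = s. *)
have h6 : (s' - s) * q%:Z = r + 1 - r' by lia.
nia.
Qed.

(* Raising the intercept by 1 / q changes a single value in each period. *)
Lemma phase_succ_except c m :
  exists k0, forall k, (0 < k <= q)%N -> k <> k0 ->
    phase p q (c + 1) (m * q + k) = phase p q c (m * q + k).
Proof.
(* The value can change only where [P] holds. As p is invertible modulo q, at most one of q
   consecutive indices satisfies it. *)
pose P k := (q%:Z %| (m * q + k)%N%:Z * p + c + 1)%Z.
have [[k0 [k0q Pk0]]|noP] := pselect (exists k0, (0 < k0 <= q)%N /\ P k0).
  exists k0 => k kq kk0; apply: phase_succ => Pk; apply: kk0.
  have : (q%:Z %| k%:Z - k0%:Z)%Z.
    rewrite -(@Gauss_dvdzl _ _ p) 1?coprimez_sym //.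
    have -> : (k%:Z - k0%:Z) * p = ((m * q + k)%N%:Z * p + c + 1)
       - ((m * q + k0)%N%:Z * p + c + 1) by rewrite !PoszD; ring.
    exact: rpredB.
  case/dvdzP => z; have [->|[z1|z1]] : z = 0 \/ z <= -1 \/ 1 <= z by lia.
  - lia.
  - have : z * q%:Z <= - q%:Z by nia.
    lia.
  - have : q%:Z <= z * q%:Z by nia.
    lia.
exists 0 => k kq _; apply: phase_succ => Pk; apply: noP; by exists k.
Qed.

Lemma phase_near_except c c' m : `|c - c'| <= 1 ->
  exists k0, forall k, (0 < k <= q)%N -> k <> k0 ->
    phase p q c' (m * q + k) = phase p q c (m * q + k).
Proof.
move=> cc'; have [->|[->|->]] : c' = c \/ c' = c + 1 \/ c = c' + 1 by lia.
- by exists 0.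
- exact: phase_succ_except.
- have [k0 h] := phase_succ_except c' m; exists k0 => k kq kk0.
  by rewrite h.
Qed.

(** The window is cut into the periods before the switch, the period that contains it and the
    periods after it. Each cut into three costs 4, for [x] and for the reference word; each of the
    three pieces costs 2 for its rotation, and the middle one a further b^2 for its single altered
    value. *)
Lemma within_phase_switch x c c' n0 m : (0 < n0)%N -> `|c - c'| <= 1 ->
  (forall n, (n <= m * q)%N ->
     x n = phase p q (if (n < n0)%N then c else c') n) ->
  within (128 * b ^ 2) (K x 0 (m * q)) (K (phase p q 0) 0 (m * q)).
Proof.
move=> n00 cc' xE; have b0 : (0 < b ^ 2)%N by rewrite expn_gt0; lia.
have [nm|mn] := ltnP (m * q) n0.
  have -> : K x 0 (m * q) = K (phase p q c) 0 (m * q).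
    apply: (continuant_step_shift _ _ 0) => k km.
    by rewrite !add0n addr0 xE // (leq_ltn_trans km).
  have [h1 h2] := within_phase c m; split; nia.
(* With [n0.-1] in place of [n0], one gets i q < n0 <= (i + 1) q: the value at i q still belongs to
   c and the one at (i + 1) q already to c'. *)
pose i := (n0.-1 %/ q)%N; pose l := (m - i.+1)%N.
have iq1 : (i * q < n0)%N by rewrite -(prednK n00) ltnS leq_divM.
have iq2 : (n0 <= i.+1 * q)%N by rewrite -{1}(prednK n00) ltn_ceil.
have im : (i < m)%N by rewrite -(ltn_pmul2r q0); lia.
have mE : (m * q = i * q + (q + l * q))%N.
  by rewrite /l -mulSn -mulnDl; congr (_ * _)%N; lia.
have split3 y : within 4 (K y 0 (m * q))
    (K y 0 (i * q) * (K y (i * q) q * K y (i.+1 * q) (l * q))).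
  have u0 := step_word_gt0 y; rewrite mE.
  have h1 := within_cat _ 0 (i * q) (q + l * q) u0.
  have h2 := within_cat _ (i * q) q (l * q) u0.
  rewrite add0n in h1; rewrite [(i.+1 * q)%N]mulSn [(q + i * q)%N]addnC.
  exact: within_trans h1 (within_mul _ _ _ _ _ _ (within_refl _) h2).
have e1 : K x 0 (i * q) = K (phase p q c) 0 (i * q).
  apply: (continuant_step_shift _ _ 0) => k ki.
  rewrite !add0n addr0 xE; last by rewrite (leq_trans ki) // leq_mul // ltnW.
  by rewrite (leq_ltn_trans ki).
have e3 : K x (i.+1 * q) (l * q) = K (phase p q c') (i.+1 * q) (l * q).
  apply: (continuant_step_shift _ _ 0) => k kl.
  rewrite addr0 xE; last by rewrite mE mulSn; lia.
  by rewrite ltnNge (leq_trans iq2) // leq_addr.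
have [k0 hk0] := phase_near_except c c' i cc'.
have e2 : within (b ^ 2) (K x (i * q) q) (K (phase p q c) (i * q) q).
  apply: (within_step_except _ _ _ _ _ k0) => k kq kk0.
  rewrite xE; last by rewrite mE; lia.
  case: ltnP => // n0k; apply: hk0 => //; apply/andP; split => //; lia.
have p3 c1 m1 m2 : K (phase p q c1) (m1 * q) m2 = K (phase p q c1) 0 m2.
  by rewrite -[(m1 * q)%N]addn0 continuant_phase_period.
have h1 := split3 x; have h2 := split3 (phase p q 0).
rewrite e1 e3 !p3 in h1 e2 h2.
have f1 := within_phase c i; have f3 := within_phase c' l.
have f2 := within_phase c 1; rewrite !mul1n in f2.
have g2 := within_trans _ _ _ _ _ e2 f2.
have g := within_mul _ _ _ _ _ _ f1 (within_mul _ _ _ _ _ _ g2 f3).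
have := within_trans _ _ _ _ _ h1 (within_trans _ _ _ _ _ g (within_sym _ _ _ h2)).
have -> : (4 * (2 * (b ^ 2 * 2 * 2) * 4) = 128 * b ^ 2)%N by lia.
done.
Qed.

End StepWords.

(** * Comparison of a real slope with a rational one *)

Section Slopes.
Variable R : realType.
Implicit Types (theta rho r d : R) (m n k q : nat).

Definition floor_seq theta rho n : int := Num.floor (n%:R * theta + rho).

Lemma floor_divz (y : R) q : (0 < q)%N ->
  Num.floor y = (Num.floor (q%:R * y) %/ q%:Z)%Z.
Proof.
move=> q0; set z := Num.floor (_ * y).
have h := floor_itv (q%:R * y); rewrite -/z in h.
have q0R : 0 < q%:R :> R by rewrite ltr0n.
have zE := divz_eq z q%:Z.
have r0 : 0 <= (z %% q%:Z)%Z by rewrite modz_ge0 //; lia.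
have r1 : (z %% q%:Z)%Z + 1 <= q%:Z by rewrite lezD1 ltz_pmod.
move: (z %/ q%:Z)%Z (z %% q%:Z)%Z zE r0 r1 => s t zE r0 r1.
apply: floor_def; move: h; rewrite zE !intrD intrM -!pmulrn => h.
move: r0 r1; rewrite -(ler_int R) -[_ + 1 <= _](ler_int R) intrD -!pmulrn.
move: h => /andP[h1 h2] r0 r1; apply/andP; split.
  by rewrite -(ler_pM2l q0R); nra.
by rewrite -(ltr_pM2l q0R); nra.
Qed.

(** The sequence r + k d is monotone and varies by less than 1 on the window, so its floor moves at
    most once, by at most one. If it never moves, [n0] is put past the end of the window. *)
Lemma floor_switch r d n : n%:R * `|d| < 1 ->
  exists n0 c c', [/\ (0 < n0)%N, `|c - c'| <= 1 &
    forall k, (k <= n)%N ->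
      Num.floor (r + k%:R * d) = if (k < n0)%N then c else c'].
Proof.
move=> nd; pose f k := Num.floor (r + k%:R * d).
have near k : (k <= n)%N -> `|k%:R * d| < 1.
  move=> kn; rewrite normrM normr_nat (le_lt_trans _ nd) //.
  by rewrite ler_wpM2r // ler_nat.
have mono k l : (k <= l <= n)%N ->
    (f 0%N <= f k <= f l) && (f l <= f 0%N + 1) \/
    (f l <= f k <= f 0%N) && (f 0%N - 1 <= f l).
  move=> /andP[kl ln]; rewrite /f !mul0r !addr0.
  have := near l ln; rewrite ltr_norml => /andP[l1 l2].
  have kl' : k%:R <= l%:R :> R by rewrite ler_nat.
  have k0 : 0 <= k%:R :> R by [].
  have [d0|d0] := leP 0 d.
    left; rewrite !le_floor /=; [|nra|nra].
    rewrite -ltzD1 floor_lt_int 2!intrD.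
    have := floorD1_gt r; rewrite intrD; lra.
  right; rewrite !le_floor /=; [|nra|nra].
  rewrite floor_ge_int intrB.
  have := floor_le r; lra.
have [[n0 [n0n fn0]]|no] := pselect (exists n0, (n0 <= n)%N /\ f n0 <> f 0%N); last first.
  exists n.+1, (f 0%N), (f 0%N); split => // [|k kn].
    by rewrite subrr normr0.
  by rewrite ltnS kn; apply: contrapT => h; apply: no; exists k.
have ex : exists n0, (n0 <= n)%N && (f n0 != f 0%N).
  by exists n0; rewrite n0n; apply/eqP.
case: (ex_minnP ex) => n1 /andP[n1n /eqP fn1] n1min.
exists n1, (f 0%N), (f n1); split.
- by rewrite lt0n; apply/eqP => n10; apply: fn1; rewrite n10.
- by have := mono n1 n1; rewrite leqnn n1n => /(_ isT); lia.
- move=> k kn; rewrite -/(f k); case: ltnP => h.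
    apply/eqP; apply: contraTT h => h; rewrite -leqNgt n1min // kn //.
  have := mono n1 k; rewrite h kn => /(_ isT); lia.
Qed.

Lemma dirichlet theta k : (0 < k)%N ->
  exists q (p : int), [/\ (0 < q <= k)%N, coprimez p q%:Z &
    k%:R * `|q%:R * theta - p%:~R| < 1].
Proof.
case: k => // k _.
(* Dividing p and q by their gcd divides the error by it as well, so coprimality can be arranged
   afterwards. *)
suff [q [p [q0k pq]]] : exists q (p : int), (0 < q <= k.+1)%N /\
    k.+1%:R * `|q%:R * theta - p%:~R| < 1.
  have q0 : (0 < q)%N by case/andP: q0k.
  pose g := gcdz p q%:Z.
  have g0 : 0 < g by rewrite lt_def gcdz_eq0 negb_and orbC eqz_nat -lt0n q0.
  have := dvdz_gcdl p q%:Z; have := dvdz_gcdr p q%:Z; rewrite -/g.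
  move=> /dvdzP[q' qE] /dvdzP[p' pE].
  have q'0 : 0 < q' by nia.
  have q'q : q' <= q%:Z by nia.
  exists `|q'|%N, p'; split; first by lia.
    rewrite gtz0_abs // coprimezE; apply/eqP.
    have : gcdz p q%:Z = gcdz p' q' * g.
      by rewrite {1}pE {1}qE -mulz_gcdl gtz0_abs.
    rewrite -/g => /esym; rewrite -[RHS]mul1r => /(mulIf (lt0r_neq0 g0)).
    by case.
  rewrite natr_absz (gtr0_norm q'0).
  apply: le_lt_trans pq; rewrite ler_wpM2l //.
  rewrite [q%:R]pmulrn {1}qE {1}pE !intrM mulrAC -mulrBl normrM.
  by rewrite ler_peMr // -intr_norm ler1z; lia.
pose fr (i : nat) := i%:R * theta - (Num.floor (i%:R * theta))%:~R.
have fr0 i : 0 <= fr i by rewrite subr_ge0 floor_le.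
have fr1 i : fr i < 1.
  by have := floorD1_gt (i%:R * theta); rewrite intrD ltrBlDl.
have k0 : 0 < k.+1%:R :> R by rewrite ltr0n.
pose tr i := Num.trunc (k.+1%:R * fr i).
have trk i : (tr i < k.+1)%N.
  rewrite truncn_lt_nat ?mulr_ge0 //.
  by rewrite gtr_pMr.
have [i [j [ij jk tij]]] : exists i j, [/\ (i < j)%N, (j <= k.+1)%N & tr i = tr j].
  (* Pigeonhole: the fractional parts of i theta for 0 <= i <= k + 1 fall into k + 1 intervals of
     length 1 / (k + 1). *)
  pose box (i : 'I_k.+2) : 'I_k.+1 := Ordinal (trk i).
  have /injectivePn[i [j ij /(congr1 val) /= e]] : ~~ injectiveb box.
    by apply/injectiveP => /leq_card; rewrite !card_ord ltnn.
  have {}ij : (i : nat) <> j by move=> /val_inj; apply/eqP.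
  have [h|h] := ltnP i j; first by exists i, j; split => //; rewrite -ltnS.
  by exists j, i; split => //; [lia|rewrite -ltnS].
exists (j - i)%N, (Num.floor (j%:R * theta) - Num.floor (i%:R * theta)).
split; first by lia.
have -> : (j - i)%:R * theta
    - (Num.floor (j%:R * theta) - Num.floor (i%:R * theta))%:~R = fr j - fr i.
  by rewrite natrB ?(ltnW ij) // intrB /fr; ring.
have h i' : (tr i')%:R <= k.+1%:R * fr i' < (tr i')%:R + 1.
  by rewrite natr1; apply: truncn_itv; rewrite mulr_ge0.
have := h i; have := h j; rewrite tij -[X in X * `|_|](ger0_norm (ltW k0)).
rewrite -normrM ltr_norml; move: (fr i) (fr j) (tr j)%:R => x y z.
move=> /andP[? ?] /andP[? ?]; apply/andP; split; lra.
Qed.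

(** Neither the reference word nor the constant depends on [rho]. By [continuant_slope_shift], one
    reference value then serves for all blocks of the word. *)
Lemma within_slope a b theta rho (p : int) q m : (0 < a < b)%N -> (0 < q)%N ->
  coprimez p q%:Z -> (m * q)%:R * `|q%:R * theta - p%:~R| < 1 ->
  within (128 * b ^ 2)
    (continuant (step_word a b (floor_seq theta rho)) 0 (m * q))
    (continuant (step_word a b (phase p q 0)) 0 (m * q)).
Proof.
move=> /andP[a0 ab] q0 cpq hd.
have [n0 [c [c' [n00 cc' H]]]] := floor_switch (q%:R * rho) _ _ hd.
apply: (within_phase_switch _ _ _ _ _ _ q0 cpq _ c c' n0) => // n nm.
rewrite -H // /floor_seq (floor_divz _ _ q0) /phase; congr (_ %/ _)%Z.
have -> : q%:R * (n%:R * theta + rho) =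
    (n%:Z * p)%:~R + (q%:R * rho + n%:R * (q%:R * theta - p%:~R)).
  by rewrite intrM -pmulrn; ring.
by rewrite floorDzr ?intr_int // intrKfloor.
Qed.

Lemma continuant_slope_shift a b theta i n :
  continuant (step_word a b (floor_seq theta 0)) i n =
  continuant (step_word a b (floor_seq theta (i%:R * theta))) 0 n.
Proof.
apply: (continuant_step_shift _ _ _ _ 0) => k _.
by rewrite /floor_seq !addr0 -mulrDl -natrD [(k + i)%N]addnC.
Qed.

End Slopes.
Arguments floor_seq {R}.

(** * Growth rate of a word cut into comparable blocks *)

Lemma within_blocks u l A C : (forall k, 0 < u k)%N ->
  (forall j, within C (continuant u (j * l) l) A) ->
  forall N, within ((2 * C) ^ N) (continuant u 0 (N * l)) (A ^ N).
Proof.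
move=> u0 H; elim=> [|N IH]; first by split.
have h := within_cat u 0 (N * l) l u0; rewrite add0n in h.
rewrite [(N.+1 * l)%N]mulSnr 2!expnSr
  (_ : _ * (2 * C) = 2 * ((2 * C) ^ N * C))%N; last first.
  by rewrite mulnCA.
exact: within_trans h (within_mul _ _ _ _ _ _ IH (H N)).
Qed.

Lemma within_growth u b l A C n : (forall k, 0 < u k <= b)%N -> (0 < l)%N ->
  (forall j, within C (continuant u (j * l) l) A) ->
  within (2 * ((2 * C) ^ (n %/ l) * b.+1 ^ l)) (continuant u 0 n) (A ^ (n %/ l)).
Proof.
move=> ub l0 H; have u0 k : (0 < u k)%N by case/andP: (ub k).
have h := within_cat u 0 (n %/ l * l) (n %% l) u0; rewrite -divn_eq in h.
rewrite add0n in h.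
apply: within_trans h _; rewrite -[(A ^ _)%N]muln1.
apply: within_mul; first exact: within_blocks.
split; last by rewrite muln_gt0 expn_gt0 /= continuant_gt0.
rewrite muln1 (leq_trans (continuant_le_exp _ b _ _ _)) //.
  by move=> k; case/andP: (ub k).
by rewrite leq_pexp2l // ltnW // ltn_mod.
Qed.

Section Growth.
Variable R : realType.

Lemma ln_within C m n : (0 < m)%N -> (0 < n)%N -> within C m n ->
  `|ln (m%:R : R) - ln n%:R| <= ln C%:R.
Proof.
move=> m0 n0 [h1 h2]; have C0 : (0 < C)%N by nia.
have half (k l : nat) : (0 < k)%N -> (0 < l)%N -> (k <= C * l)%N ->
    ln (k%:R : R) <= ln C%:R + ln l%:R.
  move=> k0 l0 kl; rewrite -lnM ?posrE ?ltr0n // ler_ln ?posrE ?mulr_gt0 ?ltr0n //.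
  by rewrite -natrM ler_nat.
by rewrite ler_norml; have := half _ _ m0 n0 h1; have := half _ _ n0 m0 h2; lra.
Qed.

Lemma ln_natX (m n : nat) : (0 < m)%N -> ln ((m ^ n)%N%:R : R) = n%:R * ln m%:R.
Proof. by move=> m0; rewrite natrX lnXn ?ltr0n // mulr_natl. Qed.

Lemma ln_natM (m n : nat) : (0 < m)%N -> (0 < n)%N ->
  ln ((m * n)%N%:R : R) = ln m%:R + ln n%:R.
Proof. by move=> m0 n0; rewrite natrM lnM ?posrE ?ltr0n. Qed.

(** Each block loses at most ln (2 C), which gives a linear error of rate O(1 / l). The bounded term
    collects the last cut, the incomplete block, and the replacement of the number of full blocks by
    n / l. *)
Lemma growth_rate u b l A C n :
  (forall k, 0 < u k <= b)%N -> (0 < l)%N -> (0 < A)%N -> (0 < C)%N ->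
  (forall j, within C (continuant u (j * l) l) A) ->
  `|ln ((continuant u 0 n)%:R : R) - n%:R * (ln A%:R / l%:R)|
  <= n%:R * (ln (2 * C)%N%:R / l%:R)
     + (ln 2 + l%:R * ln b.+1%:R + ln A%:R).
Proof.
move=> ub l0 A0 C0 H; have u0 k : (0 < u k)%N by case/andP: (ub k).
have C20 : (0 < 2 * C)%N by rewrite muln_gt0.
have A1 : (0 < A ^ (n %/ l))%N by rewrite expn_gt0 A0.
have h := ln_within _ _ _ (continuant_gt0 _ 0 n u0) A1
  (within_growth _ _ _ _ _ n ub l0 H).
rewrite !ln_natM ?muln_gt0 ?expn_gt0 ?C20 // !ln_natX // in h.
move: h.
set N := (n %/ l)%N; set X := ln (continuant _ _ _)%:R; set LA := ln A%:R.
set LC := ln (2 * C)%N%:R.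
set L2 := ln (2 : R); set LB := ln b.+1%:R.
have LA0 : 0 <= LA by rewrite ln_ge0 // ler1n.
have LC0 : 0 <= LC by rewrite ln_ge0 // ler1n.
have lR : 0 < l%:R :> R by rewrite ltr0n.
have nl1 : N%:R <= n%:R / l%:R :> R.
  by rewrite ler_pdivlMr // -natrM ler_nat leq_divM.
have nl2 : n%:R / l%:R <= N%:R + 1 :> R.
  by rewrite ler_pdivrMr // natr1 -natrM ler_nat ltnW // ltn_ceil.
rewrite (mulrCA _ LA) (mulrCA _ LC); move: (n%:R / l%:R) nl1 nl2 => y nl1 nl2.
rewrite !ler_norml => /andP[h1 h2].
have e1 : 0 <= (y - N%:R) * LA by rewrite mulr_ge0 // subr_ge0.
have e2 : 0 <= (N%:R + 1 - y) * LA by rewrite mulr_ge0 // subr_ge0.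
have e3 : 0 <= (y - N%:R) * LC by rewrite mulr_ge0 // subr_ge0.
apply/andP; split; lra.
Qed.

Definition growth (u : nat -> nat) (n : nat) : R :=
  n%:R^-1 * ln (continuant u 0 n)%:R.

(* Locally uniform in the slope, so that it gives both the existence of the
   limit and its continuity. *)
Lemma growth_slope_locally_cauchy a b (theta e : R) : (0 < a < b)%N -> 0 < e ->
  exists f d : R, 0 < d /\ forall theta', `|theta' - theta| < d ->
    \forall n \near \oo,
      `|growth (step_word a b (floor_seq theta' 0)) n - f| <= e.
Proof.
move=> ab e0; have [a0 hab] := andP ab.
pose C := (128 * b ^ 2)%N; pose D : R := ln (2 * C)%N%:R.
have C0 : (0 < C)%N by rewrite muln_gt0 expn_gt0 /=; lia.
have D0 : 0 <= D by rewrite ln_ge0 // ler1n muln_gt0.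
(* As k <= 2 l, this choice yields D + 1 <= e l. So D / l leaves a margin of at least 1 / l below e,
   which absorbs the bounded error E / n once n >= E l. *)
pose k := (Num.trunc (2 * (D + 1) / e)).+1.
have kD : 2 * (D + 1) / e < k%:R by exact: truncnS_gt.
have [q [p [/andP[q0 qk] cpq hd]]] := dirichlet _ theta k isT.
pose m := (k %/ q)%N; pose l := (m * q)%N.
have m0 : (0 < m)%N by rewrite divn_gt0.
have l0 : (0 < l)%N by rewrite muln_gt0 m0.
have lk : (l <= k)%N by rewrite leq_divM.
have kl : (k <= 2 * l)%N.
  have := ltn_ceil k q0; rewrite -/m /l => h.
  by rewrite (leq_trans (ltnW h)) //; nia.
have lR : 0 < l%:R :> R by rewrite ltr0n.
have qR : 0 < q%:R :> R by rewrite ltr0n.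
pose A := continuant (step_word a b (phase p q 0)) 0 l.
have A0 : (0 < A)%N by apply: continuant_gt0; apply: step_word_gt0.
have hl : l%:R * `|q%:R * theta - p%:~R| < 1.
  by apply: le_lt_trans hd; rewrite ler_wpM2r // ler_nat.
(* The radius is the largest for which the triangle inequality still gives l |q theta' - p| < 1, so
   p / q serves for all nearby slopes. *)
exists (ln A%:R / l%:R), ((1 - l%:R * `|q%:R * theta - p%:~R|) / (l%:R * q%:R)).
split; first by rewrite divr_gt0 ?mulr_gt0 // subr_gt0.
move=> theta' ht; set u := step_word _ _ _.
have ub j : (0 < u j <= b)%N.
  by rewrite step_word_gt0 //= step_word_le.
have H j : within C (continuant u (j * l) l) A.
  rewrite continuant_slope_shift; apply: within_slope => //; rewrite -/l.
  rewrite ltr_pdivlMr ?mulr_gt0 // in ht.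
  have -> : q%:R * theta' - p%:~R =
    q%:R * (theta' - theta) + (q%:R * theta - p%:~R) by ring.
  have := ler_normD (q%:R * (theta' - theta)) (q%:R * theta - p%:~R).
  rewrite normrM normr_nat -(ler_pM2l lR); nra.
pose E : R := ln 2 + l%:R * ln b.+1%:R + ln A%:R.
have E0 : 0 <= E.
  by rewrite !addr_ge0 ?mulr_ge0 ?ln_ge0 ?ler1n.
exists (Num.trunc (E * l%:R)).+1 => //= n hn.
have nE : E * l%:R <= n%:R.
  by rewrite ltW // (lt_le_trans (truncnS_gt _)) // ler_nat.
have n0 : 0 < n%:R :> R by rewrite ltr0n (leq_trans _ hn).
have := growth_rate _ _ _ _ _ n ub l0 A0 C0 H.
rewrite -/D -/E -/(growth u n).
set f := ln _ / _; set X := ln _; move=> h.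
have -> : growth u n - f = (X - n%:R * f) / n%:R.
  by rewrite /growth -/X; field; rewrite gt_eqF.
rewrite normrM normfV normr_nat ler_pdivrMr //; apply: (le_trans h).
have h1 : D + 1 <= e * l%:R.
  have : k%:R <= 2 * l%:R :> R by rewrite -natrM ler_nat.
  rewrite ltr_pdivrMr // in kD; nra.
rewrite -(ler_pM2r lR) mulrDl; set Y := n%:R * _ * _.
have -> : Y = n%:R * D by rewrite /Y -mulrA divfK // gt_eqF.
nra.
Qed.

End Growth.
Arguments growth {R}.

(** The centre [f] may vary with [e], so this is a form of the Cauchy criterion: no candidate limit
    has to be known. *)
Lemma cvgn_approx (R : realType) (x : nat -> R) :
  (forall e, 0 < e -> exists f, \forall n \near \oo, `|x n - f| <= e) -> cvgn x.
Proof.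
move=> H; apply/cauchy_cvgP; apply: cauchy_exP => e e0.
have [f hf] := H (e / 2) (divr_gt0 e0 (ltr0n R 2)).
exists f; rewrite /ball /=; near=> n.
rewrite /ball_ /= distrC (@le_lt_trans _ _ (e / 2)) //; last by lra.
by near: n.
Unshelve. all: by end_near. Qed.

(* Convertible to the anonymous sequence in cf_val. *)
Definition cf_coef (u : nat -> nat) (k : nat) : int :=
  if k is 0%N then 0 else (u k)%:Z.

(** * Continued fractions: from the value of a word back to its continuants *)

Section ContinuedFractions.
Variable R : realType.
Implicit Types (u : nat -> nat) (n : nat).

Lemma cf_fin_addl (x : int) s : cf_fin x s = x%:Q + cf_fin 0 s.
Proof. by case: s => [|y s] /=; rewrite ?addr0 ?add0r. Qed.

Lemma cf_conv_tail u n : cf_conv (cf_coef u) n.+1 =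
  ((u 1%N)%:Q + cf_conv (cf_coef (fun k => u k.+1)) n)^-1.
Proof.
rewrite /cf_conv /= add0r cf_fin_addl; congr (_ + cf_fin _ _)^-1.
rewrite (iotaDl 1 1) -map_comp; apply/eq_in_map => k.
by rewrite mem_iota; case: k.
Qed.

Lemma cf_conv_continuant u n : (forall k, 0 < u k)%N ->
  cf_conv (cf_coef u) n.+1 = (continuant u 1 n)%:Q / (continuant u 0 n.+1)%:Q.
Proof.
elim: n u => [|n IH] u u0; rewrite cf_conv_tail.
  by rewrite addr0 continuant1 /= mul1r.
rewrite IH //.
have tl i m : continuant (fun k => u k.+1) i m = continuant u i.+1 m.
  by apply: eq_continuant => k _; rewrite addSn.
rewrite !tl continuantSS.
have K0 : (continuant u 1 n.+1)%:Q != 0.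
  by rewrite intr_eq0 eqz_nat -lt0n continuant_gt0.
have -> : (u 1 * continuant u 1 n.+1 + continuant u 2 n)%N%:Q =
   (u 1%N)%:Q * (continuant u 1 n.+1)%:Q + (continuant u 2 n)%:Q.
  by rewrite PoszD PoszM intrD intrM.
rewrite -[RHS]invf_div; congr (_^-1).
by rewrite mulrDl mulfK.
Qed.

(** The recursion for continuants is a step of the Euclidean algorithm. Hence the fraction in
    [cf_conv_continuant] is reduced and [denq] reads off its denominator. *)
Lemma coprime_continuant u i n :
  coprime (continuant u i.+1 n) (continuant u i n.+1).
Proof.
elim: n i => [|n IH] i; first by rewrite coprime1n.
by rewrite continuantSS /coprime gcdnMDl -/(coprime _ _) coprime_sym.
Qed.

Lemma denq_cf_conv u n : (forall k, 0 < u k)%N ->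
  denq (cf_conv (cf_coef u) n) = (continuant u 0 n)%:Z.
Proof.
move=> u0; case: n => [|n]; first by rewrite /cf_conv /= denq_int.
rewrite cf_conv_continuant // coprimeq_den ?coprime_continuant //.
by rewrite eqz_nat eqn0Ngt continuant_gt0.
Qed.

Local Notation conv u n := (ratr (cf_conv (cf_coef u) n) : R).

Lemma conv0 u : conv u 0%N = 0.
Proof. by rewrite /cf_conv /= rmorph0. Qed.

Lemma convS u n : conv u n.+1 = ((u 1%N)%:R + conv (fun k => u k.+1) n)^-1.
Proof. by rewrite cf_conv_tail fmorphV rmorphD /= ratr_int. Qed.

Lemma conv_itv u n : (forall k, 0 < u k)%N -> 0 <= conv u n <= 1.
Proof.
elim: n u => [|n IH] u u0; first by rewrite conv0 lexx ler01.
rewrite convS; have /andP[h0 _] := IH (fun k => u k.+1) (fun k => u0 _).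
have u1 : 1 <= (u 1%N)%:R :> R by rewrite ler1n.
by rewrite invr_ge0 invf_le1; lra.
Qed.

(* Two steps of x |-> 1 / (u + x) contract distances by a factor 4. *)
Lemma conv_contract u n m m' : (forall k, 0 < u k)%N ->
  `|conv u (n.*2 + m)%N - conv u (n.*2 + m')%N| <= 4^-1 ^+ n.
Proof.
elim: n u => [|n IH] u u0.
  have /andP[? ?] := conv_itv u m u0; have /andP[? ?] := conv_itv u m' u0.
  by rewrite !add0n expr0 ler_norml; lra.
rewrite doubleS !addSn !convS /=.
have := IH (fun k => u k.+2) (fun k => u0 _).
have /andP[] := conv_itv (fun k => u k.+2) (n.*2 + m) (fun k => u0 _).
have /andP[] := conv_itv (fun k => u k.+2) (n.*2 + m') (fun k => u0 _).
set x := conv _ (_ + m'); set y := conv _ (_ + m).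
move: x y => x y x0 x1 y0 y1 h.
have : 1 <= (u 1%N)%:R :> R by rewrite ler1n.
have : 1 <= (u 2%N)%:R :> R by rewrite ler1n.
move: (u 1%N)%:R (u 2%N)%:R => s t t1 s1.
have hy : 2 <= s * (t + y) + 1 by nra.
have hx : 2 <= s * (t + x) + 1 by nra.
have P0 : 0 < (s * (t + y) + 1) * (s * (t + x) + 1) by nra.
have -> : (s + (t + y)^-1)^-1 - (s + (t + x)^-1)^-1 =
    (y - x) / ((s * (t + y) + 1) * (s * (t + x) + 1)).
  by field; rewrite !gt_eqF //; nra.
rewrite normrM normfV (gtr0_norm P0) exprS mulrC ler_pM //.
  by rewrite invr_ge0 ltW.
by rewrite lef_pV2 ?posrE //; nra.
Qed.

Lemma cf_val_cvg u : (forall k, 0 < u k)%N -> conv u n @[n --> \oo] --> cf_val R u.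
Proof.
move=> u0; apply: (@cvgn_approx R (fun n => conv u n)) => e e0.
have q1 : `|4^-1 : R| < 1 by rewrite ger0_norm ?invr_ge0 // invf_lt1 // ltr1n.
have /cvgrPdist_le /(_ e e0) [N _ hN] := cvg_geometric 1 q1.
exists (conv u N.*2); exists N.*2 => //= n hn.
have := conv_contract u N (n - N.*2) 0 u0; rewrite addn0 subnKC // => h.
apply: (le_trans h); have := hN N (leqnn N).
by rewrite /= sub0r normrN /geometric /= mul1r ger0_norm ?exprn_ge0 ?invr_ge0.
Qed.

Lemma cf_val_itv u : (forall k, 0 < u k)%N -> 0 <= cf_val R u <= 1.
Proof.
move=> u0; have h := cf_val_cvg u u0.
have hc : cvgn (fun n => conv u n) by apply: cvgP h.
apply/andP; split.
  by apply: limr_ge => //; near=> n; case/andP: (conv_itv u n u0).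
by apply: limr_le => //; near=> n; case/andP: (conv_itv u n u0).
Unshelve. all: by end_near. Qed.

Lemma cf_val_tail u : (forall k, 0 < u k)%N ->
  cf_val R u = ((u 1%N)%:R + cf_val R (fun k => u k.+1))^-1.
Proof.
move=> u0; have u0' k : (0 < u k.+1)%N by [].
have h := cf_val_cvg u u0; have h' := cf_val_cvg _ u0'.
apply: (@norm_cvg_unique _ R (conv u n.+1 @[n --> \oo])).
  by move: h; rewrite -(cvg_shiftS (fun n => conv u n)).
rewrite (_ : (fun n => conv u n.+1) =
  (fun n => ((u 1%N)%:R + conv (fun k => u k.+1) n)^-1)); last first.
  by apply/funext => n; rewrite convS.
apply: cvgV; last by apply: cvgD => //; exact: cvg_cst.
have /andP[h0 _] := cf_val_itv _ u0'.
by rewrite gt_eqF // ltr_wpDr // ltr0n.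
Qed.

Lemma cf_val_oitv u : (forall k, 0 < u k)%N -> 0 < cf_val R u < 1.
Proof.
move=> u0; have pos v : (forall k, 0 < v k)%N -> 0 < cf_val R v.
  move=> v0; rewrite cf_val_tail // invr_gt0 ltr_wpDr ?ltr0n //.
  by case/andP: (cf_val_itv (fun k => v k.+1) (fun k => v0 _)).
rewrite pos // cf_val_tail //.
have := pos (fun k => u k.+1) (fun k => u0 _).
have : 1 <= (u 1%N)%:R :> R by rewrite ler1n.
by move=> h1 h2; rewrite invf_lt1; lra.
Qed.

(** Infinite descent: a value p / q in (0, 1) has the tail q / p - u_1 = (q - u_1 p) / p, whose
    denominator p is smaller than q. *)
Lemma cf_val_irrational u : (forall k, 0 < u k)%N -> irrational (cf_val R u).
Proof.
move=> u0 /rationalP[p [q e]].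
have /andP[A0 _] := cf_val_oitv u u0.
(* The inverse of 0 is 0 by convention, so q = 0 would make the value 0. *)
have q0 : (0 < q)%N.
  by rewrite lt0n; apply: contraTneq A0 => q0; rewrite e q0 invr0 mulr0 ltxx.
have {e A0} : cf_val R u * q%:R = p%:~R by rewrite e divfK // pnatr_eq0 -lt0n.
elim/ltn_ind: q u p u0 q0 => q IH u p u0 q0 e.
have /andP[A0 A1] := cf_val_oitv u u0.
have q0R : 0 < q%:R :> R by rewrite ltr0n.
have p0 : 0 < p by rewrite -(ltr0z R) -e mulr_gt0.
have pq : p < q%:Z by rewrite -(ltr_int R) -e -pmulrn gtr_pMl.
apply: (IH `|p|%N _ (fun k => u k.+1) (q%:Z - (u 1%N)%:Z * p)) => //; [lia|lia|].
rewrite natr_absz (gtr0_norm p0) intrB intrM -!pmulrn -e.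
have := cf_val_tail u u0 => eA.
have eT : cf_val R (fun k => u k.+1) = (cf_val R u)^-1 - (u 1%N)%:R.
  by rewrite eA invrK addrC addKr.
by rewrite eT; field; rewrite gt_eqF.
Qed.

(** Tails lie strictly between 0 and 1, so each floor returns exactly the current coefficient, which
    is 0 at n = 0 whatever [u 0] is. *)
Lemma complete_quotient_cf_val u n : (forall k, 0 < u k)%N ->
  complete_quotient (cf_val R u) n =
  (cf_coef u n)%:~R + cf_val R (fun k => u (k + n)%N).
Proof.
move=> u0; elim: n => [|n IH] /=.
  by rewrite add0r; congr (cf_val R _); apply/funext => k; rewrite addn0.
rewrite IH; have u0' k : (0 < u (k + n))%N by [].
have h := cf_val_oitv _ u0'.
have -> : Num.floor ((cf_coef u n)%:~R + cf_val R (fun k => u (k + n)%N)) = cf_coef u n.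
  rewrite floorDzr ?intr_int // intrKfloor; apply/eqP; rewrite -[eqbRHS]addr0.
  rewrite (inj_eq (addrI _)) floor_eq add0r; case/andP: h => h0 h1.
  by rewrite ltW.
rewrite addrC addKr cf_val_tail // invrK; congr (_ + cf_val R _).
by apply/funext => k; rewrite addnS.
Qed.

Lemma partial_quotient_cf_val u : (forall k, 0 < u k)%N ->
  partial_quotient (cf_val R u) = cf_coef u.
Proof.
move=> u0; apply/funext => n; rewrite /partial_quotient complete_quotient_cf_val //.
have u0' k : (0 < u (k + n))%N by [].
have /andP[h0 h1] := cf_val_oitv _ u0'.
apply: floor_def; rewrite intrD lerDl ltrD2l ltW //.
Qed.

Lemma levy_seq_cf_val u : (forall k, 0 < u k)%N ->
  levy_seq (cf_val R u) = growth u.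
Proof.
move=> u0; apply/funext => n.
by rewrite /levy_seq /cf_denom partial_quotient_cf_val // denq_cf_conv // -pmulrn.
Qed.

End ContinuedFractions.

(** * Growth of mechanical words as a function of the slope *)

Section MechanicalWords.
Variables (R : realType) (a b : nat).
Hypothesis hab : (0 < a < b)%N.
Implicit Types theta : R.

Local Notation slope_word theta := (step_word a b (floor_seq theta 0)).

Lemma growth_mech_floor theta :
  growth (mech_floor a b theta 0) = growth (slope_word theta) :> (nat -> R).
Proof.
apply/funext => n; rewrite /growth; congr (_ * ln _%:R).
apply: eq_continuant => k _; rewrite /mech_floor /step_word /floor_seq.
by rewrite subr_eq0 -natr1 addrK.
Qed.

(* The letters only record where the sequence of integer parts moves, so the
   ceiling word of slope theta is the floor word of slope - theta. *)
Lemma growth_mech_ceil theta :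
  growth (mech_ceil a b theta 0) = growth (slope_word (- theta)) :> (nat -> R).
Proof.
apply/funext => n; rewrite /growth; congr (_ * ln _%:R).
apply: eq_continuant => k _; rewrite /mech_ceil /step_word /floor_seq.
rewrite subr_eq0 -natr1 addrK !addr0 !ceilNfloor (inj_eq oppr_inj).
by rewrite !mulrN.
Qed.

Lemma mechanical0_itv u : mechanical0 R a b u -> forall k, (a <= u k <= b)%N.
Proof.
have ab : (a <= b)%N by lia.
case=> theta _ [->|->] k; rewrite /mech_floor /mech_ceil; case: ifP => _;
  by rewrite leqnn ab.
Qed.

Lemma growth_slope_cvg theta : cvgn (growth (slope_word theta) : nat -> R).
Proof.
apply: cvgn_approx => e e0.
have [f [d [d0 h]]] := growth_slope_locally_cauchy R a b theta e hab e0.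
by exists f; apply: h; rewrite subrr normr0.
Qed.

Lemma growth_mechanical0_cvg u : mechanical0 R a b u -> cvgn (growth u : nat -> R).
Proof.
case=> theta _ [->|->]; rewrite ?growth_mech_floor ?growth_mech_ceil;
  exact: growth_slope_cvg.
Qed.

Lemma growth_limit_continuous :
  continuous (fun theta => limn (growth (slope_word theta)) : R).
Proof.
move=> theta; apply/cvgrPdist_le => e e0.
have e20 : 0 < e / 2 by rewrite divr_gt0.
have [f [d [d0 h]]] := growth_slope_locally_cauchy R a b theta (e / 2) hab e20.
(* The centre [f] is the same for all these t, so the limits at t and at theta are compared through
   it. *)
have near_f t : `|t - theta| < d -> `|limn (growth (slope_word t)) - f| <= e / 2.
  move=> /h ht; have c := growth_slope_cvg t.
  rewrite ler_distl; apply/andP; split.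
    by apply: limr_ge => //; near=> n; have : `|growth (slope_word t) n - f| <= e / 2;
      [near: n | rewrite ler_distl => /andP[]].
  by apply: limr_le => //; near=> n; have : `|growth (slope_word t) n - f| <= e / 2;
      [near: n | rewrite ler_distl => /andP[]].
have h0 : `|limn (growth (slope_word theta)) - f| <= e / 2.
  by apply: near_f; rewrite subrr normr0.
near=> t.
have ht : `|limn (growth (slope_word t)) - f| <= e / 2.
  by apply: near_f; near: t; exact: cvgr_distC_lt.
move: h0 ht; rewrite !ler_norml => /andP[? ?] /andP[? ?].
apply/andP; split; lra.
Unshelve. all: by end_near. Qed.

Lemma growth_mono (u v : nat -> nat) (n : nat) :
  (forall k, 0 < u k)%N -> (forall k, u k <= v k)%N -> growth u n <= growth v n :> R.
Proof.
move=> u0 uv; rewrite ler_wpM2l ?invr_ge0 // ler_ln ?posrE ?ltr0n.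
- by rewrite ler_nat continuant_mono.
- exact: continuant_gt0.
- by apply: continuant_gt0 => k; rewrite (leq_trans (u0 k)).
Qed.

Lemma mech_floor_slope0 : mech_floor a b (0 : R) 0 = fun=> a.
Proof. by apply/funext => n; rewrite /mech_floor !mulr0 subrr eqxx. Qed.

Lemma mech_floor_slope1 : mech_floor a b (1 : R) 0 = fun=> b.
Proof.
apply/funext => n; rewrite /mech_floor !mulr1 !addr0.
rewrite -[n%:R - 1]/(n%:~R - 1%:~R) -intrB pmulrn !intrKfloor.
by rewrite opprB addrC subrK.
Qed.

End MechanicalWords.

Theorem theorem1p2 (R : realType) (a b : nat) (ha : (1 <= a)%N)
    (hab : (a < b)%N) :
  (forall u : nat -> nat, mechanical0 R a b u ->
     has_levy_constant (cf_val R u)) /\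
  [set levy_constant (cf_val R u) | u in mechanical0 R a b] =
  `[levy_constant (cf_val R (fun=> a)), levy_constant (cf_val R (fun=> b))]%classic.
Proof.
have ab : (0 < a < b)%N by rewrite ha.
have itv := mechanical0_itv R a b ab.
have pos u : mechanical0 R a b u -> forall k, (0 < u k)%N.
  by move=> /itv H k; case/andP: (H k) => /(leq_trans ha).
have levyE u : (forall k, 0 < u k)%N -> levy_constant (cf_val R u) = limn (growth u).
  by move=> u0; rewrite /levy_constant levy_seq_cf_val.
have mech0 : mechanical0 R a b (fun=> a).
  exists 0; first by rewrite lexx ler01.
  by left; rewrite mech_floor_slope0.
have mech1 : mechanical0 R a b (fun=> b).
  exists 1; first by rewrite lexx ler01.
  by left; rewrite mech_floor_slope1.
have cvg u := growth_mechanical0_cvg R a b ab u.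
split=> [u hu|].
  split; first exact: cf_val_irrational (pos u hu).
  by rewrite levy_seq_cf_val; [exact: cvg|exact: pos].
rewrite !levyE; [|by move=> _; lia..].
apply/seteqP; split => [_ [u hu <-]|y] /=.
  rewrite levyE; last exact: pos.
  rewrite in_itv /=; apply/andP; split.
    apply: ler_lim; [exact: cvg|exact: cvg|].
    by near=> n; apply: growth_mono => k; case/andP: (itv _ hu k).
  apply: ler_lim; [exact: cvg|exact: cvg|].
  by near=> n; apply: growth_mono => k; [exact: pos|case/andP: (itv _ hu k)].
rewrite in_itv /= => hy.
(* [L] is continuous on the whole line, and the slopes 0 and 1 give the constant words, hence the
   two endpoints. Floor words alone already attain every value between them. *)
pose L (theta : R) : R := limn (growth (step_word a b (floor_seq theta 0))).
have L0 : L 0 = limn (growth (fun=> a)).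
  by rewrite /L -growth_mech_floor mech_floor_slope0.
have L1 : L 1 = limn (growth (fun=> b)).
  by rewrite /L -growth_mech_floor mech_floor_slope1.
have [theta ht Lt] : exists2 theta, theta \in `[0, 1] & L theta = y.
  apply: IVT => //.
    exact/continuous_subspaceT/growth_limit_continuous.
  rewrite L0 L1; case/andP: hy => h1 h2.
  by rewrite ge_min h1 le_max h2 orbT.
have hu : mechanical0 R a b (mech_floor a b theta 0).
  by exists theta; [move: ht; rewrite in_itv|left].
exists (mech_floor a b theta 0) => //.
by rewrite levyE; [rewrite growth_mech_floor|exact: pos].
Unshelve. all: by end_near. Qed.
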